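(* Let $p$ be a prime, let $E$ be an elementary abelian $p$-group of order $q$, let $\Bbbk$ be a field of characteristic $p$, and let $V$ be a faithful indecomposable $\Bbbk E$-module of dimension $2$. Let $m,d$ be integers with $m<q$, $d<q$ and $m+d\geq q$. Then $S^d(S^m(V)^* )$ is projective relative to the set of subgroups of $E$ of order $\leq m$.
   Context: $S^d(-)$ denotes the $d$-th symmetric power with its usual group action, and $M^*$ the dual (contragredient) module of $M$. For a finite group $G$ and a set $\mathcal{X}$ of subgroups of $G$, a finitely generated $\Bbbk G$-module $M$ is projective relative to $\mathcal{X}$ if it is a direct summand of $\bigoplus_{H\in\mathcal{X}} M\downarrow_H\uparrow_H^G$, where $\downarrow_H$ is restriction to $H$ and $N\uparrow_H^G=\Bbbk G\otimes_{\Bbbk H}N$ is induction. *)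

(* Defs.v *)
From mathcomp Require Import all_boot all_order all_algebra.
From mathcomp Require Import all_fingroup all_solvable all_field all_character.
From mathcomp Require Import mpoly.

Set Implicit Arguments.
Unset Strict Implicit.
Unset Printing Implicit Defensive.

Import GRing.Theory.
Local Open Scope ring_scope.

(* A finite-dimensional kG-module is a matrix representation                   *)
(* rG : mx_representation F G n, acting on row vectors on the right: with      *)
(* (e_i) the standard basis, e_i . g = \sum_j (rG g) i j e_j.  A left module   *)
(* is read as a right module through v . g = g^-1 v; this is compatible with   *)
(* duals, symmetric powers, restriction and induction.                         *)

Section Modules.

Variables (F : fieldType) (gT : finGroupType).

Definition mx_indecomposable (G : {group gT}) n
    (rG : mx_representation F G n) : Prop :=
  (0 < n)%N /\
  forall U W : 'M[F]_n, mxmodule rG U -> mxmodule rG W ->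
    (U + W :=: 1%:M)%MS -> mxdirect (U + W) -> U = 0 \/ W = 0.

Section Dual.

Variables (G : {group gT}) (n : nat) (rG : mx_representation F G n).

Lemma dual_mx_repr : mx_repr G (fun g => (rG g^-1%g)^T).
Proof.
split=> [|x y Gx Gy]; first by rewrite invg1 repr_mx1 trmx1.
by rewrite invMg repr_mxM ?groupV // trmx_mul.
Qed.

(* In the dual basis: (f . g)(v) = f (v . g^-1). *)
Definition dual_repr := MxRepresentation dual_mx_repr.

End Dual.

Section SymmetricPower.

(* S^d(M) is the degree d component of the polynomial ring on a basis 'X_i of  *)
(* M, with G acting by the algebra automorphisms extending its action on M;    *)
(* matrices are written in the basis of the monomials of degree d.             *)

Definition monomials n d : {set 'X_{1..n < d.+1}} :=
  [set m : 'X_{1..n < d.+1} | mdeg m == d].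

Definition monomial n d (i : 'I_#|monomials n d|) : 'X_{1..n} :=
  bmnm (enum_val i).

Definition linear_forms n (A : 'M[F]_n) : n.-tuple {mpoly F[n]} :=
  [tuple \sum_(j < n) A i j *: 'X_j | i < n].

Definition sym_mx n d (A : 'M[F]_n) : 'M[F]_#|monomials n d| :=
  \matrix_(i, j) ('X_[monomial i] \mPo linear_forms A)@_(monomial j).

Lemma monomial_inj n d : injective (@monomial n d).
Proof. by move=> i j /val_inj /enum_val_inj. Qed.

Lemma mdeg_monomial n d (i : 'I_#|monomials n d|) : mdeg (monomial i) = d.
Proof. by have := enum_valP i; rewrite inE => /eqP. Qed.

Lemma monomial_onto n d (m : 'X_{1..n}) :
  mdeg m = d -> exists i : 'I_#|monomials n d|, monomial i = m.
Proof.
move=> dm; have lt_m : (mdeg m < d.+1)%N by rewrite dm.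
have Sm : BMultinom lt_m \in monomials n d by rewrite inE /= dm.
by exists (enum_rank_in Sm (BMultinom lt_m)); rewrite /monomial enum_rankK_in.
Qed.

Lemma dhomog_monomialE n d (p : {mpoly F[n]}) :
  p \is d.-homog ->
  p = \sum_(i < #|monomials n d|) p@_(monomial i) *: 'X_[monomial i].
Proof.
move=> hp; apply/mpolyP=> m; rewrite raddf_sum /=.
have [dm|dm] := eqVneq (mdeg m) d; last first.
  rewrite (dhomog_nemf_coeff hp dm) big1 // => i _.
  rewrite mcoeffZ mcoeffX; case: eqP => [mi|_]; last by rewrite mulr0.
  by rewrite -mi mdeg_monomial eqxx in dm.
have [k <-] := monomial_onto dm.
rewrite (bigD1 k) //= mcoeffZ mcoeffX eqxx mulr1 big1 ?addr0 // => i ik.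
by rewrite mcoeffZ mcoeffX (inj_eq (@monomial_inj n d)) (negPf ik) mulr0.
Qed.

Lemma linear_form_homog n (A : 'M[F]_n) i :
  tnth (linear_forms A) i \is 1.-homog.
Proof.
rewrite tnth_mktuple rpred_sum // => j _; apply: rpredZ.
by rewrite dhomogX; apply/eqP; rewrite /= mdeg1.
Qed.

Lemma linear_forms_homog n d (A : 'M[F]_n) (i : 'I_#|monomials n d|) :
  'X_[monomial i] \mPo linear_forms A \is d.-homog.
Proof.
rewrite comp_mpolyX -[d in d.-homog](mdeg_monomial i) mdegE.
elim/big_ind2: _ => [|p a q b|k _]; [exact: dhomog1 | exact: dhomogM |].
rewrite -[X in X.-homog]mul1n.
exact/dhomogMn/linear_form_homog.
Qed.

Lemma comp_linear_formsM n (A B : 'M[F]_n) (p : {mpoly F[n]}) :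
  p \mPo linear_forms (A *m B) = (p \mPo linear_forms A) \mPo linear_forms B.
Proof.
have {}mor (m : 'X_{1..n}) :
  'X_[m] \mPo linear_forms (A *m B)
    = ('X_[m] \mPo linear_forms A) \mPo linear_forms B.
  rewrite !comp_mpolyX rmorph_prod; apply: eq_bigr => i _ /=.
  rewrite rmorphXn /=; congr (_ ^+ _).
  rewrite !tnth_mktuple raddf_sum /=.
  under [RHS]eq_bigr => j _ do
    rewrite comp_mpolyZ comp_mpolyXU -tnth_nth tnth_mktuple scaler_sumr.
  rewrite exchange_big /=; apply: eq_bigr => k _.
  rewrite mxE scaler_suml; by apply: eq_bigr => j _; rewrite scalerA.
rewrite comp_mpolyEX [X in _ = X \mPo _]comp_mpolyEX raddf_sum /=.
by apply: eq_bigr => m _; rewrite comp_mpolyZ mor.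
Qed.

Lemma comp_linear_forms1 n (p : {mpoly F[n]}) : p \mPo linear_forms 1%:M = p.
Proof.
rewrite -[RHS]comp_mpoly_id; congr (_ \mPo _); apply: eq_from_tnth => i.
rewrite !tnth_mktuple (bigD1 i) //= mxE eqxx scale1r big1 ?addr0 // => j ji.
by rewrite mxE eq_sym (negPf ji) scale0r.
Qed.

Variables (G : {group gT}) (n : nat) (d : nat) (rG : mx_representation F G n).

Lemma sym_mx_repr : mx_repr G (fun g => sym_mx d (rG g)).
Proof.
split=> [|x y Gx Gy]; apply/matrixP=> i j; rewrite !mxE.
  by rewrite repr_mx1 comp_linear_forms1 mcoeffX (inj_eq (@monomial_inj n d)).
rewrite repr_mxM // comp_linear_formsM.
rewrite [X in X \mPo linear_forms (rG y)](dhomog_monomialE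
  (linear_forms_homog (rG x) i)).
rewrite (raddf_sum (comp_mpoly (linear_forms (rG y)))) raddf_sum /=.
apply: eq_bigr => k _.
by rewrite comp_mpolyZ mcoeffZ !mxE.
Qed.

Definition sym_repr := MxRepresentation sym_mx_repr.

End SymmetricPower.

Section Induction.

(* For a right kH-module N with basis (e_i), N (x)_{kH} kG has basis           *)
(* (e_i (x) t), where t runs over the representatives repr A of the right      *)
(* cosets A of H in G, and (e_i (x) t) g = (e_i . t g u^-1) (x) u, where u is  *)
(* the representative of H t g (so that t g u^-1 lies in H).                   *)

Variables (G H : {group gT}) (sHG : H \subset G).
Variables (n : nat) (rH : mx_representation F H n).

Definition right_coset (i : 'I_#|rcosets H G|) : {set gT} := enum_val i.

Definition ind_block (g : gT) (i j : 'I_#|rcosets H G|) : 'M[F]_n :=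
  if (right_coset i :* g == right_coset j)%g
  then rH (repr (right_coset i) * g * (repr (right_coset j))^-1)%g
  else 0.

Definition ind_mx (g : gT) : 'M[F]_(\sum_(i < #|rcosets H G|) n) :=
  \mxblock_(i, j) ind_block g i j.

Lemma right_cosetP i : right_coset i = (H :* repr (right_coset i))%g.
Proof.
rewrite /right_coset; have /rcosetsP[x _ ->] := enum_valP i.
by rewrite rcoset_repr.
Qed.

Lemma right_coset_inj : injective right_coset.
Proof. exact: enum_val_inj. Qed.

Lemma right_coset_act g i :
  g \in G -> exists j, (right_coset i :* g)%g = right_coset j.
Proof.
move=> Gg; have /rcosetsP[x Gx def_i] := enum_valP i.
have Hxg : (right_coset i :* g)%g \in rcosets H G.
  by rewrite /right_coset def_i -rcosetM mem_rcosets mulSGid // groupM.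
by exists (enum_rank_in Hxg (right_coset i :* g)%g);
  rewrite /right_coset enum_rankK_in.
Qed.

Lemma right_coset_mem g i j :
  (right_coset i :* g)%g = right_coset j ->
  (repr (right_coset i) * g * (repr (right_coset j))^-1)%g \in H.
Proof.
move=> eq_ij; rewrite -mem_rcoset -right_cosetP -eq_ij.
by rewrite mem_rcoset mulgK right_cosetP mem_repr_rcoset.
Qed.

Lemma ind_mx_repr : mx_repr G ind_mx.
Proof.
split=> [|x y Gx Gy]; rewrite /ind_mx.
  rewrite -mxdiagZ; apply: eq_mxblock => i j.
  rewrite /ind_block rcoset1 (inj_eq right_coset_inj).
  by case: eqVneq => [->|//]; rewrite conform_mx_id mulg1 mulgV repr_mx1.
rewrite mul_mxblock; apply: eq_mxblock => i j.
have [k def_k] := right_coset_act i Gx.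
rewrite (bigD1 k) //= big1 ?addr0 => [|l lk]; last first.
  by rewrite /ind_block def_k (inj_eq right_coset_inj) eq_sym (negPf lk) mul0mx.
rewrite /ind_block def_k eqxx rcosetM def_k.
case: eqP => [eq_j|_]; last by rewrite mulmx0.
rewrite -repr_mxM ?right_coset_mem //; congr (rH _).
by rewrite !mulgA mulgKV.
Qed.

Definition ind_repr := MxRepresentation ind_mx_repr.

End Induction.

Section RelativeProjectivity.

Variable G : {group gT}.

Definition subgroup_of := {H : {group gT} | H \subset G}.

Definition res_ind n (rG : mx_representation F G n) (H : subgroup_of) :
    representation F G :=
  Representation (ind_repr (valP H) (subg_repr rG (valP H))).

Definition relatively_projective (X : {set subgroup_of}) n
    (rG : mx_representation F G n) : Prop :=
  exists K : representation F G,
    mx_rsim (\big[@dadd_grepr F gT G/grepr0]_(H in X) res_ind rG H)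
            (dadd_grepr (Representation rG) K).

End RelativeProjectivity.

End Modules.

(* Main.v *)
Require Import Defs.
From mathcomp Require Import all_boot all_order all_algebra.
From mathcomp Require Import all_fingroup all_solvable all_field all_character.
From mathcomp Require Import mpoly.

(** The module is identified with an exterior power that E almost permutes.

    A nonzero fixed vector y of the p-group E shows that V has a basis x, y with
    x . g = x + a(g) y and y . g = y; as V is faithful, a : E -> F is an
    injective additive character (shear_form).  Dehomogenizing y = 1, S^m(V)
    becomes the space of polynomials of degree at most m in one variable X, with
    E acting by translations, and S^m(V)^* is the space of functionals on it
    (dual_sym_shear_rsim).

    The dual of S^d(S^m(V)^* ) consists of the symmetric polynomials in
    X_1, ..., X_d of degree at most m in each variable, with E translating all
    variables simultaneously.  The Vandermonde determinant in the X_i is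
    invariant under such translations, and multiplication by it is a bijection
    onto the alternating polynomials of degree less than m + d in each variable.
    Hence S^d(S^m(V)^* ) is isomorphic to the d-th exterior power of W, the
    space of functionals on polynomials of degree less than m + d; this is the
    Wronskian isomorphism (sym_translation_rsim).

    Put q = #|E|.  The evaluations at the q points b(g) = a(g^-1) belong to W
    and E permutes them regularly.  Since m + d >= q, some polynomial of degree
    less than m + d vanishes at all of these points but one; its translates
    split off the evaluations, so W is the direct sum of the regular module and
    a module K of dimension m + d - q (translation_regular_split).

    The d-th exterior power of F[E] (+) K is the direct sum of subspaces indexed
    by the subsets B of E, where B records which basis elements of F[E] occur in
    a wedge product, and E permutes these subspaces by translating B.  A nonzero
    one has d - dim K <= #|B| <= d, that is q - m <= #|B| < q
    (card_group_trace).  The stabilizer of B acts freely on the nonempty set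
    E \ B, so its order is at most q - #|B| <= m
    (leq_card_translation_stab).  The projections onto the subspaces add up to
    the identity and are permuted by E, so the identity is a sum of transfers
    from those stabilizers, and Higman's criterion (higman_criterion) gives the
    relative projectivity. *)

Set Implicit Arguments.
Unset Strict Implicit.
Unset Printing Implicit Defensive.

Import GRing.Theory.
Local Open Scope ring_scope.

(** * Higman's criterion *)

Section Split.
Variables (F : fieldType) (gT : finGroupType) (G : {group gT}).

(** The complement is the kernel of the retraction T. *)
Lemma rsim_split N n (rR : mx_representation F G N)
    (rM : mx_representation F G n) (S : 'M_(n, N)) (T : 'M_(N, n)) :
    (forall g, g \in G -> rM g *m S = S *m rR g) ->
    (forall g, g \in G -> rR g *m T = T *m rM g) ->
    S *m T = 1%:M ->
  exists K : representation F G, mx_rsim rR (dadd_grepr (Representation rM) K).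
Proof.
move=> homS homT ST1.
have modK : mxmodule rR (kermx T).
  apply/mxmoduleP=> g Gg; apply/sub_kermxP.
  by rewrite -mulmxA homT // mulmxA mulmx_ker mul0mx.
exists (Representation (submod_repr modK)).
have rT : \rank T = n.
  apply/eqP; rewrite eqn_leq rank_leq_col /=.
  by rewrite -[X in (X <= _)%N](@mxrank1 F n) -ST1 mxrankM_maxr.
have sK : (1%:M - T *m S <= kermx T)%MS.
  by apply/sub_kermxP; rewrite mulmxBl mul1mx -mulmxA ST1 mulmx1 subrr.
exists (row_mx T (in_submod (kermx T) (1%:M - T *m S))) => [||g Gg].
- by rewrite /= mxrank_ker rT subnKC // -rT rank_leq_row.
- apply/inj_row_free => u; rewrite mul_mx_row -[0]row_mx0.
  case/eq_row_mx => uT0.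
  rewrite in_submodE mulmxA -in_submodE.
  move/(congr1 (val_submod (U := kermx T))).
  rewrite in_submodK ?(submx_trans (submxMl _ _) sK) // linear0.
  by rewrite mulmxBr mulmx1 mulmxA uT0 mul0mx subr0.
- rewrite /= mul_row_block !mulmx0 addr0 add0r mul_mx_row homT //.
  congr row_mx; rewrite -in_submodJ // in_submodE mulmxA -in_submodE.
  congr in_submod.
  by rewrite mulmxBr mulmx1 mulmxBl mul1mx mulmxA homT // -!mulmxA homS.
Qed.

End Split.

Section Higman.
Variables (F : fieldType) (gT : finGroupType) (G : {group gT}).
Variables (n : nat) (rG : mx_representation F G n).

(** The relative trace from H to G of an endomorphism A commuting with H. *)
Definition transfer (H : {group gT}) (A : 'M[F]_n) : 'M[F]_n :=
  \sum_(X in rcosets H G) rG (repr X)^-1%g *m A *m rG (repr X).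

Definition factors_through (R : representation F G) (A : 'M[F]_n) : Prop :=
  exists S : 'M_(n, rdegree R), exists T : 'M_(rdegree R, n),
    [/\ forall g, g \in G -> rG g *m S = S *m R g,
        forall g, g \in G -> R g *m T = T *m rG g & S *m T = A].

Lemma factors_through_grepr0 : factors_through grepr0 0.
Proof.
exists 0, 0; split=> [g _|g _|]; rewrite ?mulmx0 ?mul0mx //.
Qed.

Lemma factors_through_dadd R1 R2 A1 A2 :
  factors_through R1 A1 -> factors_through R2 A2 ->
  factors_through (dadd_grepr R1 R2) (A1 + A2).
Proof.
move=> [S1 [T1 [homS1 homT1 <-]]] [S2 [T2 [homS2 homT2 <-]]].
exists (row_mx S1 S2), (col_mx T1 T2); split=> [g Gg|g Gg|] /=.
- by rewrite mul_mx_row mul_row_block !mulmx0 addr0 add0r homS1 ?homS2.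
- by rewrite mul_block_col mul_col_mx !mul0mx addr0 add0r homT1 ?homT2.
- by rewrite mul_row_col.
Qed.

(** With (v (x) t) the vectors of the induced module, T sends v (x) t to
    (v A) t, and S sends w to the sum of all (w t^-1) (x) t. *)
Lemma factors_through_res_ind (H : subgroup_of G) (A : 'M_n) :
    (forall h, h \in val H -> rG h *m A = A *m rG h) ->
  factors_through (res_ind rG H) (transfer (val H) A).
Proof.
case: H => H /= sHG; rewrite /transfer => cA.
have GH (i : 'I_#|rcosets H G|) : repr (right_coset i) \in G.
  have /rcosetsP[x Gx def_i] := enum_valP i.
  rewrite /right_coset def_i; have := mem_repr_rcoset H x.
  by case/rcosetP=> h Hh ->; rewrite groupM // (subsetP sHG).
pose t i := repr (@right_coset gT G H i).
exists (\mxrow_(i < #|rcosets H G|) rG (t i)^-1%g).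
exists (\mxcol_(i < #|rcosets H G|) (A *m rG (t i))).
split=> [g Gg|g Gg|] /=.
- rewrite mul_mxrow mul_mxrow_mxblock; apply: eq_mxrow => j.
  have [i def_i] := right_coset_act sHG j (groupVr Gg).
  have def_j : (right_coset i :* g)%g = right_coset j.
    by rewrite -def_i -rcosetM mulVg rcoset1.
  rewrite (bigD1 i) //= big1 ?addr0 => [|l li].
    rewrite /ind_block def_j eqxx /= -!repr_mxM ?groupM ?groupV ?GH //.
    by rewrite !mulgA mulVg mul1g.
  rewrite /ind_block; case: eqP => [def_l|_]; last by rewrite mulmx0.
  case/eqP: li; apply: right_coset_inj.
  by apply: (can_inj (rcosetK g)); rewrite def_l.
- rewrite mxcol_mul.
  rewrite /ind_mx mul_mxblock_mxrow.
  apply: eq_mxcol => i; have [j def_j] := right_coset_act sHG i Gg.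
  rewrite (bigD1 j) //= big1 ?addr0 => [|l lj].
    have Hh := right_coset_mem def_j.
    rewrite /ind_block def_j eqxx /= mulmxA cA // -!mulmxA; congr (_ *m _).
    rewrite -!repr_mxM ?groupM ?groupV ?GH //.
    by rewrite mulgKV.
  rewrite /ind_block def_j (inj_eq (@right_coset_inj _ _ _)) eq_sym.
  by rewrite (negPf lj) mul0mx.
- rewrite mul_mxrow_mxcol [RHS]big_enum_val /=.
  by apply: eq_bigr => i _; rewrite mulmxA.
Qed.

(** Only the sufficiency half: an identity that is a sum of transfers factors
    through the sum of the modules restricted to H and induced back. *)
Lemma higman_criterion (X : {set subgroup_of G})
    (A : subgroup_of G -> 'M[F]_n) :
    (forall H h, H \in X -> h \in val H -> rG h *m A H = A H *m rG h) ->
    \sum_(H in X) transfer (val H) (A H) = 1%:M ->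
  relatively_projective X rG.
Proof.
move=> cA sumA.
have [S [T [homS homT ST]]] : factors_through
    (\big[@dadd_grepr F gT G/grepr0]_(H in X) res_ind rG H)
    (\sum_(H in X) transfer (val H) (A H)).
  apply: (big_rec2 factors_through) => [|H R B XH].
    exact: factors_through_grepr0.
  apply: factors_through_dadd.
  by apply: factors_through_res_ind => h; apply: cA.
by apply: rsim_split homS homT _; rewrite ST.
Qed.

End Higman.

Section PermutedFamily.
Variables (F : fieldType) (gT : finGroupType) (G : {group gT}).
Variables (n : nat) (rG : mx_representation F G n).
Variables (T : finType) (to : {action gT &-> T}) (P : T -> 'M[F]_n).
Hypothesis permP : forall g b, g \in G -> P b *m rG g = rG g *m P (to b g).

Let conjP g b : g \in G -> rG g^-1%g *m P b *m rG g = P (to b g).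
Proof.
move=> Gg; rewrite -mulmxA permP // mulmxA -repr_mxM ?groupV //.
by rewrite mulVg repr_mx1 mul1mx.
Qed.

(** Right cosets of the stabilizer of b correspond to points of its orbit. *)
Lemma transfer_stab b :
  transfer rG 'C_G[b | to]%G (P b) = \sum_(c in orbit to G b) P c.
Proof.
rewrite orbit_stabilizer ?subsetT // big_imset /=; last first.
  exact: can_in_inj (act_reprK (subsetT _)).
apply: eq_bigr => Y /rcosetsP[x Gx ->].
rewrite conjP //.
have /rcosetP[y /setIP[Gy _] ->] := mem_repr_rcoset 'C_G[b | to]%G x.
exact: groupM.
Qed.

(** The sum over each orbit is the transfer of one of its members from its
    stabilizer.  The orbit representatives with the same stabilizer H are added
    up, since each H occurs only once in the induced sum. *)
Lemma permuted_family_relatively_projective (X : {set subgroup_of G}) :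
    \sum_b P b = 1%:M ->
    (forall b, P b != 0 -> exists2 H, H \in X & val H = 'C_G[b | to]%G) ->
  relatively_projective X rG.
Proof.
move=> sumP stabX.
(* The pick depends on the orbit only, so it is constant on orbits. *)
pose rep c := odflt c [pick b in orbit to G c].
have rep_in c : rep c \in orbit to G c.
  rewrite /rep; case: pickP => [b //|/(_ c)]; by rewrite orbit_refl.
have repE b c : (b \in orbit to G c) -> rep b = rep c.
  move=> bc; have obc : orbit to G b = orbit to G c by apply/orbit_eqP.
  by rewrite /rep obc; case: pickP => // /(_ c); rewrite orbit_refl.
have repP b c : rep b = b -> (rep c == b) = (c \in orbit to G b).
  move=> bb; apply/eqP/idP=> [<-|/repE->//]; by rewrite orbit_sym.
pose A (H : subgroup_of G) : 'M[F]_n :=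
  \sum_(b | (rep b == b) && (val H == 'C_G[b | to]%G)) P b.
apply: (higman_criterion (A := A)) => [H h XH Hh|].
  rewrite mulmx_sumr mulmx_suml; apply: eq_bigr => b /andP[_ /eqP defH].
  move: Hh; rewrite defH => /setIP[Gh /astab1P cbh].
  by rewrite permP // cbh.
have trA H : H \in X -> transfer rG (val H) (A H) =
    \sum_(b | (rep b == b) && (val H == 'C_G[b | to]%G))
      \sum_(c in orbit to G b) P c.
  move=> _; rewrite /transfer /A.
  under eq_bigr => Y _ do rewrite mulmx_sumr mulmx_suml.
  rewrite exchange_big /=; apply: eq_bigr => b /andP[_ /eqP->].
  exact: transfer_stab.
rewrite (eq_bigr _ trA) (exchange_big_dep (fun b => rep b == b)) /=; last first.
  by move=> ? ? _ /andP[].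
rewrite -sumP [RHS](partition_big rep (fun b => rep b == b)) /=; last first.
  by move=> c _; rewrite (repE _ c).
apply: eq_bigr => b /eqP repb.
rewrite [RHS](eq_bigl (mem (orbit to G b))); last by move=> c; rewrite repP.
have [Pb0|/stabX[H XH defH]] := eqVneq (P b) 0.
  have Pc0 c : c \in orbit to G b -> P c = 0.
    by case/orbitP=> g Gg <-; rewrite -conjP // Pb0 mulmx0 mul0mx.
  rewrite [RHS]big1 // big1 // => H _; exact: big1.
rewrite (big_pred1 H) // => K; rewrite repb eqxx /=.
rewrite -defH; apply/andP/eqP => [[_ /eqP/val_inj//]|->]; by rewrite XH.
Qed.

End PermutedFamily.

Lemma relatively_projective_rsim_family (F : fieldType) (gT : finGroupType)
    (G : {group gT}) n n' (rG : mx_representation F G n)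
    (rG' : mx_representation F G n') (T : finType) (to : {action gT &-> T})
    (P : T -> 'M[F]_n') (X : {set subgroup_of G}) :
    mx_rsim rG rG' ->
    (forall g b, g \in G -> P b *m rG' g = rG' g *m P (to b g)) ->
    \sum_b P b = 1%:M ->
    (forall b, P b != 0 -> exists2 H, H \in X & val H = 'C_G[b | to]%G) ->
  relatively_projective X rG.
Proof.
case/mx_rsim_def=> B [B' B'B defG] permP sumP stabP.
apply: (@permuted_family_relatively_projective _ _ _ _ _ _ to
          (fun b => B *m P b *m B')) => [g b Gg||b nzPb].
- rewrite defG // !mulmxA -(mulmxA _ B') B'B mulmx1 -(mulmxA _ B') B'B mulmx1.
  by rewrite -(mulmxA B (P b)) permP // mulmxA.
- rewrite -mulmx_suml -mulmx_sumr sumP mulmx1.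
  by rewrite -(repr_mx1 rG) defG // repr_mx1 mulmx1.
- by apply: stabP; apply: contraNneq nzPb => ->; rewrite mulmx0 mul0mx.
Qed.

(** * The Cauchy-Binet formula *)

Section CauchyBinet.
Variables (n d : nat).

Definition dsets : {set {set 'I_n}} := [set S : {set 'I_n} | #|S| == d].

Lemma card_dset (i : 'I_#|dsets|) : #|enum_val i| = d.
Proof. by have := enum_valP i; rewrite inE => /eqP. Qed.

Definition dset_elt (i : 'I_#|dsets|) (a : 'I_d) : 'I_n :=
  enum_val (cast_ord (esym (card_dset i)) a).

Lemma dset_elt_inj i : injective (dset_elt i).
Proof. by move=> a b /enum_val_inj/cast_ord_inj. Qed.

Lemma imset_dset_elt i : dset_elt i @: setT = enum_val i.
Proof.
apply/eqP; rewrite eqEcard card_imset; last exact: dset_elt_inj.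
rewrite cardsT card_ord card_dset leqnn andbT.
by apply/subsetP=> _ /imsetP[a _ ->]; apply: enum_valP.
Qed.

Lemma dset_onto (f : 'I_d -> 'I_n) :
  injective f -> exists i : 'I_#|dsets|, enum_val i = f @: setT.
Proof.
move=> injf; have Df : f @: setT \in dsets.
  by rewrite inE card_imset // cardsT card_ord.
by exists (enum_rank_in Df (f @: setT)); rewrite enum_rankK_in.
Qed.

Lemma dset_elt_perm (f : 'I_d -> 'I_n) i :
  injective f -> enum_val i = f @: setT ->
  exists s : 'S_d, forall a, f a = dset_elt i (s a).
Proof.
move=> injf def_i.
have ex a : exists b, f a == dset_elt i b.
  have: f a \in dset_elt i @: setT by rewrite imset_dset_elt def_i imset_f.
  by case/imsetP=> b _ ->; exists b.
pose s a := xchoose (ex a).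
have fs a : f a = dset_elt i (s a) by apply/eqP/(xchooseP (ex a)).
have injs : injective s by move=> a b sab; apply: injf; rewrite !fs sab.
by exists (perm injs) => a; rewrite permE fs.
Qed.

(** Expanding along columns gives a sum over all maps f; the maps that are not
    injective repeat a row of B, and the others are sorted by their image. *)
Lemma Cauchy_Binet (R : comNzRingType) (A : 'M[R]_(d, n)) (B : 'M[R]_(n, d)) :
  \det (A *m B) = \sum_(i < #|dsets|)
    \det (colsub (dset_elt i) A) * \det (rowsub (dset_elt i) B).
Proof.
have -> : \det (A *m B) = \sum_(f : {ffun 'I_d -> 'I_n})
    (\prod_a A a (f a)) * \det (rowsub f B).
  rewrite /determinant.
  under eq_bigr => s _ do under eq_bigr => a _ do rewrite mxE.
  under eq_bigr => s _ do rewrite bigA_distr_bigA mulr_sumr.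
  rewrite exchange_big; apply: eq_bigr => f _; rewrite mulr_sumr.
  apply: eq_bigr => s _; rewrite big_split /= mulrCA; congr (_ * (_ * _)).
  by apply: eq_bigr => a _; rewrite mxE.
pose P (i : 'I_#|dsets|) (f : {ffun 'I_d -> 'I_n}) :=
  injectiveb f && (enum_val i == f @: setT).
transitivity (\sum_(i < #|dsets|) \sum_(f : {ffun 'I_d -> 'I_n} | P i f)
    (\prod_a A a (f a)) * \det (rowsub f B)).
  rewrite (exchange_big_dep xpredT) //=; apply: eq_bigr => f _.
  have [/injectiveP injf|] := boolP (injectiveb f).
    have [i def_i] := dset_onto injf; rewrite [RHS](big_pred1 i) // => j.
    rewrite /P -def_i (inj_eq enum_val_inj).
    by rewrite (introT (injectiveP _) injf).
  move=> ninj; rewrite [RHS]big_pred0 => [|i]; last by rewrite /P (negPf ninj).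
  case/injectivePn: ninj => a [b ab fab].
  rewrite (determinant_alternate ab) ?mulr0 // => j.
  by rewrite !mxE fab.
apply: eq_bigr => i _.
pose h (s : 'S_d) := [ffun a => dset_elt i (s a)].
have injh : injective h.
  move=> s t /ffunP st; apply/permP=> a.
  by have := st a; rewrite !ffunE => /dset_elt_inj.
(* A left inverse of h; the default 1 is not reached on the maps f counted
   here, whose image is the set indexed by i. *)
pose h' f := odflt 1%g [pick s | h s == f].
have hK : cancel h h'.
  move=> s; rewrite /h'; case: pickP => [t /eqP/injh //|/(_ s)].
  by rewrite eqxx.
rewrite (reindex_onto h h') /=; last first.
  move=> f /andP[/injectiveP injf /eqP/(dset_elt_perm injf)[s fs]].
  by have -> : f = h s; [apply/ffunP=> a; rewrite ffunE | rewrite hK].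
rewrite [LHS](eq_bigl xpredT) => [|s]; last first.
  rewrite hK eqxx andbT /P; apply/andP; split.
    by apply/injectiveP=> a b; rewrite !ffunE => /dset_elt_inj/perm_inj.
  rewrite -imset_dset_elt; apply/eqP/setP=> k.
  apply/imsetP/imsetP=> [[a _ ->]|[a _ ->]].
    by exists (s^-1%g a) => //; rewrite ffunE permKV.
  by exists (s a) => //; rewrite ffunE.
rewrite mulr_suml; apply: eq_bigr => s _.
have -> : rowsub (h s) B = row_perm s (rowsub (dset_elt i) B).
  by apply/matrixP=> a b; rewrite !mxE ffunE.
rewrite row_permE det_mulmx det_perm mulrCA mulrA; congr (_ * _ * _).
by apply: eq_bigr => a _; rewrite !mxE ffunE.
Qed.

End CauchyBinet.

(** * Functoriality of exterior, symmetric and dual modules *)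

Lemma det_neq0_transversal (R : comNzRingType) d (A : 'M[R]_d) :
  \det A != 0 -> exists s : 'S_d, forall a, A a (s a) != 0.
Proof.
move=> nz; pose good (s : 'S_d) := [forall a, A a (s a) != 0].
have [/existsP[s /forallP ps]|] := boolP [exists s, good s]; first by exists s.
rewrite negb_exists => /forallP none; case/eqP: nz.
rewrite /determinant big1 // => s _; have := none s.
rewrite negb_forall => /existsP[a]; rewrite negbK => /eqP Aa0.
by rewrite (bigD1 a) //= Aa0 mul0r mulr0.
Qed.

Section ExteriorPowers.
Variable F : fieldType.

(** The d-th compound matrix. *)
Definition ext_mx n d (A : 'M[F]_n) : 'M[F]_#|dsets n d| :=
  \matrix_(i, j) \det (mxsub (dset_elt i) (dset_elt j) A).

Lemma ext_mxM n d (A B : 'M[F]_n) :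
  ext_mx d (A *m B) = ext_mx d A *m ext_mx d B.
Proof.
apply/matrixP=> i j; rewrite !mxE.
have -> : mxsub (dset_elt i) (dset_elt j) (A *m B) =
    rowsub (dset_elt i) A *m colsub (dset_elt j) B.
  by apply/matrixP=> a b; rewrite !mxE; apply: eq_bigr => k _; rewrite !mxE.
rewrite Cauchy_Binet; apply: eq_bigr => k _; rewrite !mxE.
by congr (_ * _); congr determinant; apply/matrixP=> a b; rewrite !mxE.
Qed.

Lemma ext_mx1 n d : ext_mx d 1%:M = 1%:M :> 'M[F]_#|dsets n d|.
Proof.
apply/matrixP=> i j; rewrite !mxE.
have [<-|ij] := eqVneq i j.
  rewrite -[RHS](det1 _ d); congr (\det _); apply/matrixP=> a b.
  by rewrite !mxE (inj_eq (@dset_elt_inj _ _ i)).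
apply/eqP; apply: contraNT ij => /det_neq0_transversal[s sP].
have eq_ij a : dset_elt i a = dset_elt j (s a).
  by apply/eqP; apply: contraTT (sP a); rewrite !mxE => /negPf->; rewrite eqxx.
rewrite -(inj_eq enum_val_inj) eqEcard !card_dset leqnn andbT.
rewrite -imset_dset_elt; apply/subsetP=> _ /imsetP[a _ ->].
by rewrite eq_ij enum_valP.
Qed.

Variables (gT : finGroupType) (G : {group gT}).

Lemma ext_mx_repr n d (rG : mx_representation F G n) :
  mx_repr G (fun g => ext_mx d (rG g)).
Proof.
by split=> [|x y Gx Gy]; rewrite ?repr_mx1 ?ext_mx1 // repr_mxM // ext_mxM.
Qed.

Definition ext_repr n d (rG : mx_representation F G n) :=
  MxRepresentation (ext_mx_repr d rG).

Lemma ext_repr_rsim n1 n2 d (r1 : mx_representation F G n1)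
    (r2 : mx_representation F G n2) :
  mx_rsim r1 r2 -> mx_rsim (ext_repr d r1) (ext_repr d r2).
Proof.
case=> B def_n; case: _ / def_n in r2 B *.
rewrite row_free_unit => uB homB; exists (ext_mx d B) => // [|x Gx].
  rewrite row_free_unit.
  suff /mulmx1_unit[] : ext_mx d B *m ext_mx d (invmx B) = 1%:M by [].
  by rewrite -ext_mxM mulmxV // ext_mx1.
by rewrite /= -!ext_mxM homB.
Qed.

End ExteriorPowers.

Section SymmetricPowersAndDuals.
Variable F : fieldType.

Lemma sym_mxM n d (A B : 'M[F]_n) :
  sym_mx d (A *m B) = sym_mx d A *m sym_mx d B.
Proof.
apply/matrixP=> i j; rewrite !mxE comp_linear_formsM.
rewrite [X in X \mPo linear_forms B](dhomog_monomialE
  (linear_forms_homog A i)).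
rewrite (raddf_sum (comp_mpoly (linear_forms B))) raddf_sum /=.
by apply: eq_bigr => k _; rewrite comp_mpolyZ mcoeffZ !mxE.
Qed.

Lemma sym_mx1 n d : sym_mx d 1%:M = 1%:M :> 'M[F]_#|monomials n d|.
Proof.
apply/matrixP=> i j; rewrite !mxE comp_linear_forms1 mcoeffX.
by rewrite (inj_eq (@monomial_inj n d)).
Qed.

Variables (gT : finGroupType) (G : {group gT}).

Lemma sym_repr_rsim n1 n2 d (r1 : mx_representation F G n1)
    (r2 : mx_representation F G n2) :
  mx_rsim r1 r2 -> mx_rsim (sym_repr d r1) (sym_repr d r2).
Proof.
case=> B def_n; case: _ / def_n in r2 B *.
rewrite row_free_unit => uB homB; exists (sym_mx d B) => // [|x Gx].
  rewrite row_free_unit.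
  suff /mulmx1_unit[] : sym_mx d B *m sym_mx d (invmx B) = 1%:M by [].
  by rewrite -sym_mxM mulmxV // sym_mx1.
by rewrite /= -!sym_mxM homB.
Qed.

Lemma dual_repr_rsim n1 n2 (r1 : mx_representation F G n1)
    (r2 : mx_representation F G n2) :
  mx_rsim r1 r2 -> mx_rsim (dual_repr r1) (dual_repr r2).
Proof.
case=> B def_n; case: _ / def_n in r2 B *.
rewrite row_free_unit => uB homB; exists (invmx B)^T => // [|x Gx].
  by rewrite row_free_unit unitmx_tr unitmx_inv.
rewrite /= -!trmx_mul; congr _^T.
by apply: (canRL (mulmxK uB)); rewrite -mulmxA homB ?groupV // mulKmx.
Qed.

End SymmetricPowersAndDuals.

(** * Translation modules *)

Lemma lift0_ord2 : lift ord0 ord0 = 1 :> 'I_2.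
Proof. exact/val_inj. Qed.

Lemma ord_eq01 (l : 'I_2) : l = 0 \/ l = 1.
Proof. by case: l => [[|[|//]] i]; [left | right]; apply/val_inj. Qed.

Lemma morph_group1 (U : zmodType) (gT : finGroupType) (G : {group gT})
    (b : gT -> U) :
  {in G &, {morph b : x y / (x * y)%g >-> x + y}} -> b 1%g = 0.
Proof. by move=> bM; apply: (addrI (b 1%g)); rewrite -bM // mulg1 addr0. Qed.

Section Translations.
Variable F : fieldType.

(** On columns of coefficients this matrix substitutes X + b for X; on row
    vectors, which are functionals on polynomials of degree less than n, it is
    therefore composition with that substitution. *)
Definition translation_mx n (b : F) : 'M[F]_n :=
  \matrix_(j, k) (('X + b%:P) ^+ k)`_j.

Lemma comp_poly_wide n (p r : {poly F}) :
  (size p <= n)%N -> p \Po r = \sum_(l < n) p`_l *: r ^+ l.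
Proof.
move=> szp; rewrite /comp_poly (@horner_coef_wide _ n) ?size_map_polyC //.
by apply: eq_bigr => l _; rewrite coef_map /= mul_polyC.
Qed.

Lemma size_XaddCn (b : F) k : size (('X + b%:P) ^+ k) = k.+1.
Proof. by rewrite -[b]opprK polyCN size_exp_XsubC. Qed.

Lemma translation_mxD n b c :
  translation_mx n b *m translation_mx n c = translation_mx n (b + c).
Proof.
apply/matrixP=> j k; rewrite !mxE.
have -> : ('X + (b + c)%:P) ^+ k = ('X + c%:P) ^+ k \Po ('X + b%:P).
  by rewrite rmorphXn /= comp_polyD comp_polyX comp_polyC -addrA -polyCD.
rewrite (@comp_poly_wide n) ?size_XaddCn // coef_sum.
by apply: eq_bigr => l _; rewrite !mxE coefZ mulrC.
Qed.

Lemma translation_mx0 n : translation_mx n 0 = 1%:M.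
Proof. by apply/matrixP=> j k; rewrite !mxE addr0 coefXn. Qed.

Lemma coef_XaddCn (a : F) k i :
  (i <= k)%N -> (('X + a%:P) ^+ k)`_i = a ^+ (k - i) *+ 'C(k, i).
Proof.
move=> le_ik; rewrite addrC exprDn coef_sum.
rewrite (bigD1 (Ordinal (le_ik : (i < k.+1)%N))) //= big1 => [|j ji].
  by rewrite addr0 coefMn -polyC_exp coefCM coefXn eqxx mulr1.
rewrite coefMn -polyC_exp coefCM coefXn.
by rewrite -val_eqE eq_sym in ji; rewrite (negPf ji) mulr0 mul0rn.
Qed.

Lemma det_translation_mx n (b : F) : \det (translation_mx n b) = 1.
Proof.
rewrite -det_tr det_trig.
  rewrite big1 // => i _; rewrite !mxE coef_XaddCn // subnn binn.
  by rewrite expr0.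
apply/is_trig_mxP=> i j lt_ij; rewrite !mxE nth_default // size_XaddCn.
exact: lt_ij.
Qed.

(** With x, y the variables of index 0 and 1, A sends x to x + a y and fixes y;
    a monomial of degree m is determined by its exponent in x. *)
Lemma sym_shear_mx m (A : 'M[F]_2) (a : F) :
  A 0 0 = 1 -> A 0 1 = a -> A 1 0 = 0 -> A 1 1 = 1 ->
  sym_mx m A = \matrix_(i, j) (('X + a%:P) ^+ monomial i 0%R)`_(monomial j 0%R).
Proof.
move=> A00 A01 A10 A11; apply/matrixP=> i j; rewrite !mxE comp_mpolyX.
have di := mdeg_monomial i; have dj := mdeg_monomial j.
move: (monomial i) (monomial j) di dj => u w.
rewrite !mdegE !big_ord_recl !big_ord0 /= !addn0 !mulr1.
rewrite !tnth_mktuple !big_ord_recl !big_ord0 !addr0.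
rewrite lift0_ord2 A00 A01 A10 A11 !scale1r scale0r add0r => du dw.
rewrite addrC exprDn mulr_suml raddf_sum /=.
have monE k : (k <= u 0%R)%N ->
    ((U_(0%R) *+ k + U_(1%R) *+ (u 0%R - k + u 1%R))%MM == w)
      = (k == w 0%R).
  move=> le_ku; apply/eqP/eqP=> [<-|def_k].
    by rewrite mnmDE !mulmnE !mnm1E /= mul1n mul0n addn0.
  apply/mnmP=> l; rewrite mnmDE !mulmnE !mnm1E.
  case: (ord_eq01 l) => ->; rewrite /= ?mul1n ?mul0n ?addn0 ?add0n //.
  by rewrite addnBAC // du -dw def_k addKn.
have term k : (k <= u 0%R)%N ->
    ((a *: 'X_1) ^+ (u 0%R - k) * 'X_0 ^+ k *+ 'C(u 0%R, k)
       * 'X_1 ^+ u 1%R)@_w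
    = (a ^+ (u 0%R - k) *+ 'C(u 0%R, k)) * (k == w 0%R)%:R.
  move=> le_ku; rewrite -(monE k le_ku) -mcoeffX -mcoeffZ mpolyXD -!mpolyXn.
  rewrite exprD exprZn mulrnAl -!scalerAl scalerMnl; congr (_ *: _)@__.
  by rewrite mulrCA mulrA.
under eq_bigr => k _ do rewrite term -1?ltnS //.
have [le_wu|lt_uw] := leqP (w 0%R) (u 0%R).
  rewrite coef_XaddCn // (bigD1 (Ordinal (le_wu : (w 0%R < (u 0%R).+1)%N))) //=.
  rewrite eqxx mulr1 big1 ?addr0 // => k; rewrite -val_eqE /= => /negPf->.
  by rewrite mulr0.
rewrite nth_default ?size_XaddCn // big1 // => k _.
by rewrite ltn_eqF ?mulr0 // (leq_trans (ltn_ord k)).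
Qed.

Variables (gT : finGroupType) (G : {group gT}) (b : gT -> F).
Hypothesis bM : {in G &, {morph b : x y / (x * y)%g >-> x + y}}.

Lemma translation_mx_repr n : mx_repr G (fun g => translation_mx n (b g)).
Proof.
split=> [|x y Gx Gy]; first by rewrite (morph_group1 bM) translation_mx0.
by rewrite translation_mxD bM.
Qed.

Definition translation_repr n := MxRepresentation (translation_mx_repr n).

End Translations.

(** * Two-dimensional modules of p-groups *)

Section ShearModule.
Variables (F : fieldType) (gT : finGroupType) (G : {group gT}).

Definition is_shear (A : 'M[F]_2) : Prop :=
  [/\ A 0 0 = 1, A 1 0 = 0 & A 1 1 = 1].

(** The basis of S^m(V) consists of the x^k y^(m - k); matching it with the X^k
    turns the shear into the substitution X + b(g), up to transposition. *)
Lemma dual_sym_shear_rsim (V : mx_representation F G 2) (b : gT -> F)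
    (bM : {in G &, {morph b : x y / (x * y)%g >-> x + y}}) m :
    (forall g, g \in G -> is_shear (V g)) ->
    (forall g, g \in G -> V g^-1%g 0 1 = b g) ->
  mx_rsim (dual_repr (sym_repr m V)) (translation_repr bM m.+1).
Proof.
move=> shV Vb.
pose c (i : 'I_#|monomials 2 m|) : 'I_m.+1 := inord (monomial i 0%R).
have valc i : c i = monomial i 0%R :> nat.
  rewrite inordK // ltnS; have := mdeg_monomial i; move: (monomial i) => u <-.
  by rewrite mdegE (bigD1 0%R) //= leq_addr.
have injc : injective c.
  move=> i j cij; apply: monomial_inj; apply/mnmP.
  have e0 : monomial i 0%R = monomial j 0%R by rewrite -!valc cij.
  have: mdeg (monomial i) = mdeg (monomial j) by rewrite !mdeg_monomial.
  move: (monomial i) (monomial j) e0 => u w e0.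
  rewrite !mdegE !big_ord_recl !big_ord0 e0 !addn0 => /addnI e1 l.
  case: (ord_eq01 l) => ->; first exact: e0.
  by rewrite -lift0_ord2.
have ontoc k : exists i, c i == k.
  have dk : mdeg (U_(0%R) *+ k + U_(1%R) *+ (m - k) : 'X_{1..2})%MM = m.
    by rewrite mdegD !mdegMn !mdeg1 !mul1n subnKC // -ltnS.
  have [i def_i] := monomial_onto dk; exists i; apply/eqP/val_inj.
  by rewrite /= valc def_i mnmDE !mulmnE !mnm1E /= mul1n mul0n addn0.
pose e k := xchoose (ontoc k).
have eK : cancel e c by move=> k; apply/eqP/(xchooseP (ontoc k)).
have cK : cancel c e by move=> i; apply: injc; rewrite eK.
have card_mon : #|monomials 2 m| = m.+1.
  by rewrite -[LHS]card_ord -[RHS]card_ord; apply: bij_eq_card; exists e.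
exists (\matrix_(i, k) (c i == k)%:R) => // [|g Gg].
  apply/row_freeP; exists (\matrix_(k, i) (c i == k)%:R).
  apply/matrixP=> i j; rewrite !mxE (bigD1 (c i)) //= !mxE eqxx mul1r big1.
    by rewrite addr0 (inj_eq injc) eq_sym.
  by move=> k /negPf ki; rewrite !mxE eq_sym ki mul0r.
have [V00 V10 V11] := shV _ (groupVr Gg).
rewrite /= (sym_shear_mx _ V00 (Vb g Gg) V10 V11).
apply/matrixP=> i k; rewrite !mxE (bigD1 (e k)) //= big1 => [|j jk]; last first.
  by rewrite !mxE (can2_eq cK eK) (negPf jk) mulr0.
rewrite !mxE eK eqxx mulr1 addr0 (bigD1 (c i)) //= big1 => [|l li]; last first.
  by rewrite !mxE eq_sym (negPf li) mul0r.
by rewrite !mxE eqxx mul1r addr0 -!valc eK.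
Qed.

(** A nonzero fixed vector y is the second basis vector.  The character of
    V / <y> is trivial since 1 is the only p-th root of unity in
    characteristic p. *)
Lemma shear_form p (V : mx_representation F G 2) :
    p \in [pchar F] -> (p.-abelem G)%g ->
  exists2 V' : mx_representation F G 2, mx_rsim V V' &
    forall g, g \in G -> is_shear (V' g).
Proof.
move=> charFp abelG; have p_pr := pcharf_prime charFp.
have [_ Gp1] := abelemP p_pr abelG.
have fixV : rfix_mx V G != 0.
  exact: rfix_pgroup_pchar charFp _ _ _ V isT (abelem_pgroup abelG) (subxx _).
have /rowV0Pn[y fix_y nz_y] := fixV.
have Vy g : g \in G -> y *m V g = y by apply/rfix_mxP.
have [w w_y] : exists w : 'rV_2, ~~ (w <= y)%MS.
  have: ~~ ((1%:M : 'M_2) <= y)%MS.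
    by apply/negP=> /mxrankS; rewrite mxrank1 rank_rV nz_y.
  by case/row_subPn=> j nj; exists (row j 1%:M).
pose B : 'M_2 := \matrix_(j < 2) (if j == 0 then w else y).
have uB : B \in unitmx.
  rewrite -row_free_unit; apply/inj_row_free => v.
  rewrite mulmx_sum_row !big_ord_recl big_ord0 addr0 !rowK /=.
  rewrite lift0_ord2; have [v00|nz_v0] := eqVneq (v 0 0) 0.
    rewrite v00 scale0r add0r => /eqP.
    rewrite scaler_eq0 (negPf nz_y) orbF => /eqP v01.
    by apply/rowP=> j; rewrite mxE; case: (ord_eq01 j) => ->.
  move/eqP; rewrite addr_eq0 => /eqP def_w; case/negP: w_y.
  rewrite -[w](scalerK nz_v0) def_w -scaleNr scalemx_sub //.
  exact: scalemx_sub.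
pose V' := rconj_repr V uB.
have V'1 g : g \in G -> row 1 (V' g) = delta_mx 0 1.
  move=> Gg; rewrite /= /rconj_mx !row_mul rowK /= Vy //.
  by apply: (canLR (mulmxK uB)); rewrite -rowE rowK.
have V'10 g : g \in G -> V' g 1 0 = 0 by move/V'1/rowP/(_ 0); rewrite !mxE.
have V'11 g : g \in G -> V' g 1 1 = 1 by move/V'1/rowP/(_ 1); rewrite !mxE.
exists V' => [|g Gg].
  apply: mx_rsim_sym; exists B; rewrite ?row_free_unit // => x Gx.
  by rewrite /= /rconj_mx mulmxKV.
split; rewrite ?V'10 ?V'11 //.
have V'M x z : x \in G -> z \in G -> V' (x * z)%g 0 0 = V' x 0 0 * V' z 0 0.
  move=> Gx Gz; rewrite repr_mxM // mxE !big_ord_recl big_ord0 addr0.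
  by rewrite lift0_ord2 V'10 // mulr0 addr0.
have V'X k : V' (g ^+ k)%g 0 0 = V' g 0 0 ^+ k.
  elim: k => [|k IHk]; first by rewrite repr_mx1 mxE.
  by rewrite expgS exprS V'M ?groupX // IHk.
have: V' g 0 0 ^+ p = 1 by rewrite -V'X Gp1 // repr_mx1 mxE.
rewrite -(pFrobenius_autE charFp) => Vp1.
apply/eqP; rewrite -subr_eq0.
have: pFrobenius_aut charFp (V' g 0 0 - 1) == 0.
  by rewrite rmorphB /= rmorph1 Vp1 subrr.
by rewrite fmorph_eq0.
Qed.

End ShearModule.

(** * The Wronskian isomorphism *)

Lemma poly_monomials (R : nzRingType) n (p : {poly R}) :
  (size p <= n)%N -> p = \sum_(c < n) p`_c *: 'X^c.
Proof.
move=> sp; rewrite -poly_def; apply/polyP=> c; rewrite coef_poly.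
by case: ltnP => // /(leq_trans sp) szc; rewrite nth_default.
Qed.

Lemma coefM_wide (R : comNzRingType) d n (p q : {poly R}) j :
    (size p <= d)%N -> (size q <= n)%N ->
  (p * q)`_j = \sum_(l < n) (\sum_(c < d) q`_l * p`_c *+ (l + c == j)%N).
Proof.
move=> sp sq.
rewrite {1}(poly_monomials sp) {1}(poly_monomials sq).
rewrite mulr_sumr coef_sum; apply: eq_bigr => l _.
rewrite mulr_suml coef_sum; apply: eq_bigr => c _.
rewrite -scalerAl -scalerAr -exprD !coefZ coefXn mulrCA addnC mulrA eq_sym.
by rewrite mulr_natr.
Qed.

Lemma mnm_sum_onto n k (u : 'X_{1..n}) :
  mdeg u = k -> exists f : {ffun 'I_k -> 'I_n}, (\sum_a U_(f a))%MM = u.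
Proof.
elim: k u => [|k IHk] u du.
  exists (ffun0 (card_ord 0)); rewrite big_ord0.
  by apply/esym/eqP; rewrite -mdeg_eq0 du.
have [i nz_ui] : exists i, u i != 0%N.
  apply/existsP; apply: contraPT du; rewrite negb_exists => /forallP u0.
  by rewrite mdegE big1 // => i _; apply/eqP; rewrite -[_ == _]negbK u0.
have leU : (U_(i) <= u)%MM by rewrite lep1mP.
have [f def_f] : exists f : {ffun 'I_k -> 'I_n},
    (\sum_a U_(f a))%MM = (u - U_(i))%MM.
  apply: IHk; apply: succn_inj.
  by rewrite -du -[in RHS](submK leU) mdegD mdeg1 addn1.
exists [ffun a => oapp f i (unlift ord0 a)].
rewrite big_ord_recl ffunE unlift_none /= -[RHS](submK leU) addmC -def_f.
by congr (_ + _)%MM; apply: eq_bigr => a _; rewrite ffunE liftK.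
Qed.

Section Wronskian.

(** The entry (k, c) is the variable of index k - c, or 0 when there is none. *)
Definition shift_mx (R : comNzRingType) m d : 'M[{mpoly R[m.+1]}]_(m + d, d) :=
  \matrix_(k, c) \sum_(l < m.+1) 'X_l *+ (l + c == k)%N.

Section Psi.
Variables (F : fieldType) (m d : nat).
Local Notation Z := (shift_mx F m d).

(** The transpose of multiplication by the Vandermonde determinant in d
    variables, from symmetric to alternating polynomials.  In the product of
    Vandermonde and f, the coefficient of X_0^(h_0) ... X_(d-1)^(h_(d-1)) is the
    signed sum of the coefficients of f at the exponents h_a - s(a) over all
    permutations s.  Writing z_j for an exponent j, that sum is the determinant
    of the matrix with entries z_(h_a - c). *)
Definition wronski_mx : 'M[F]_(#|dsets (m + d) d|, #|monomials m.+1 d|) :=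
  \matrix_(i, u) (\det (rowsub (dset_elt i) Z))@_(monomial u).

Lemma shift_minor_homog i : \det (rowsub (dset_elt i) Z) \is d.-homog.
Proof.
rewrite /determinant rpred_sum // => s _; rewrite rpredMsign.
suff: \prod_(a < d) rowsub (dset_elt i) Z a (s a)
        \is (\sum_(a < d) 1)%N.-homog.
  by rewrite sum1_card card_ord.
apply: (big_ind2 (fun (p : {mpoly F[m.+1]}) k => p \is k.-homog)).
- exact: dhomog1.
- by move=> p1 k1 p2 k2; apply: dhomogM.
move=> a _; rewrite !mxE rpred_sum // => l _; rewrite rpredMn //.
by rewrite dhomogX /= mdeg1.
Qed.

(** The unitriangular last factor is what makes the Vandermonde determinant
    invariant under translation; entrywise this is
    (X + b)^(l + c) = (X + b)^l (X + b)^c. *)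
Lemma translation_shift_mx (b : F) :
  map_mx (@mpolyC m.+1 F) (translation_mx (m + d) b) *m Z =
  map_mx (comp_mpoly (linear_forms (translation_mx m.+1 b))) Z
    *m map_mx (@mpolyC m.+1 F) (translation_mx d b).
Proof.
apply/matrixP=> j c; rewrite !mxE.
transitivity (\sum_(l < m.+1) ((('X + b%:P) ^+ (l + c))`_j)%:MP_[m.+1] * 'X_l).
  under eq_bigr => k _ do rewrite !mxE mulr_sumr.
  rewrite exchange_big; apply: eq_bigr => l _ /=.
  have lt_lc : (l + c < m + d)%N by rewrite -addnS leq_add // -ltnS.
  rewrite (bigD1 (Ordinal lt_lc)) //= eqxx mulr1n big1 ?addr0 // => k.
  by rewrite -val_eqE eq_sym /= => /negPf->; rewrite mulr0n mulr0.
under [RHS]eq_bigr => c' _.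
  rewrite !mxE raddf_sum /= mulr_suml.
  under eq_bigr => l _.
    rewrite raddfMn /= comp_mpolyXU -tnth_nth tnth_mktuple -sumrMnl mulr_suml.
    over.
  over.
rewrite exchange_big /=; under [RHS]eq_bigr => l _ do rewrite exchange_big /=.
rewrite [RHS]exchange_big /=; apply: eq_bigr => k _.
rewrite addnC exprD (@coefM_wide _ d m.+1) ?size_XaddCn ?ltn_ord //.
rewrite raddf_sum mulr_suml; apply: eq_bigr => l _.
rewrite raddf_sum mulr_suml; apply: eq_bigr => c' _.
rewrite mxE raddfMn /= !mulrnAl; congr (_ *+ _).
by rewrite mpolyCM -mul_mpolyC mulrAC.
Qed.

(** The entries are coefficients of corresponding minors of the two sides of
    translation_shift_mx; on the left this is the Cauchy-Binet formula. *)
Lemma wronski_mx_equivariant (b : F) :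
  ext_mx d (translation_mx (m + d) b) *m wronski_mx =
  wronski_mx *m sym_mx d (translation_mx m.+1 b).
Proof.
apply/matrixP=> i u; rewrite !mxE.
transitivity (\det (rowsub (dset_elt i)
    (map_mx (@mpolyC m.+1 F) (translation_mx (m + d) b) *m Z)))@_(monomial u).
  rewrite -mul_rowsub_mx Cauchy_Binet raddf_sum /=; apply: eq_bigr => j _.
  rewrite !mxE -mcoeffCM -det_map_mx; congr (_ * _)@__.
  by congr determinant; apply/matrixP=> a c; rewrite !mxE.
rewrite translation_shift_mx -mul_rowsub_mx det_mulmx det_map_mx.
rewrite det_translation_mx mulr1 -map_mxsub det_map_mx.
rewrite /= [X in comp_mpoly _ X](dhomog_monomialE (shift_minor_homog i)).
rewrite (raddf_sum (comp_mpoly _)) raddf_sum /=; apply: eq_bigr => w _.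
by rewrite comp_mpolyZ mcoeffZ !mxE.
Qed.


(** Multiplication by the Vandermonde determinant is injective because
    polynomials form a domain.  A vector v in the kernel is read as a linear
    form L on polynomials of degree d in the z_l, with coefficients extended to
    K = F[X_0, ..., X_(d-1)].  By the Cauchy-Binet formula L kills the
    determinant of the product of (X_a^k) by the shift matrix; that determinant
    is the Vandermonde determinant times the product of the
    zeta_a = \sum_l X_a^l z_l, so L kills the latter product, and its value
    there contains every coordinate of v as a coefficient. *)
Lemma wronski_mx_free : row_free wronski_mx^T.
Proof.
apply/inj_row_free => v vW0.
pose K := {mpoly F[d]}.
pose L (p : {mpoly K[m.+1]}) : K :=
  \sum_(u < #|monomials m.+1 d|) p@_(monomial u) * (v 0 u)%:MP.
have L_sum I r (P : pred I) (f : I -> {mpoly K[m.+1]}) :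
    L (\sum_(i <- r | P i) f i) = \sum_(i <- r | P i) L (f i).
  rewrite /L exchange_big; apply: eq_bigr => u _ /=.
  by rewrite raddf_sum mulr_suml.
have LC c p : L (c%:MP * p) = c * L p.
  by rewrite /L mulr_sumr; apply: eq_bigr => u _; rewrite mcoeffCM mulrA.
pose X : 'M[K]_(d, m + d) := \matrix_(a, k) 'X_a ^+ k.
pose zeta (a : 'I_d) : {mpoly K[m.+1]} :=
  \sum_(l < m.+1) ('X_a ^+ l)%:MP * 'X_l.
pose V : 'M[K]_d := Vandermonde d (\row_a 'X_a).
have detV : \det V != 0.
  rewrite det_Vandermonde; apply/prodf_neq0 => a _; apply/prodf_neq0 => c lt_ac.
  rewrite !mxE subr_eq0; apply/eqP=> /mpolyP/(_ U_(a)%MM).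
  rewrite !mcoeffXU eqxx; case: eqP lt_ac => [->|_ _ /eqP].
    by rewrite ltnn.
  by rewrite eq_sym oner_eq0.
have factor : map_mx (@mpolyC m.+1 K) X *m shift_mx K m d =
    diag_mx (\row_a zeta a) *m (map_mx (@mpolyC m.+1 K) V)^T.
  apply/matrixP=> a c; rewrite mul_diag_mx !mxE.
  under eq_bigr => k _ do rewrite !mxE mulr_sumr.
  rewrite exchange_big mulr_suml; apply: eq_bigr => l _ /=.
  have lt_lc : (l + c < m + d)%N by rewrite -addnS leq_add // -ltnS.
  rewrite (bigD1 (Ordinal lt_lc)) //= eqxx mulr1n big1 ?addr0 => [|k].
    by rewrite exprD mpolyCM mulrAC.
  by rewrite -val_eqE eq_sym /= => /negPf->; rewrite mulr0n mulr0.
have minorK i : \det (rowsub (dset_elt i) (shift_mx K m d)) =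
    map_mpoly (@mpolyC d F) (\det (rowsub (dset_elt i) Z)).
  rewrite -det_map_mx; congr determinant; apply/matrixP=> a c; rewrite !mxE.
  rewrite raddf_sum; apply: eq_bigr => l _ /=.
  by rewrite raddfMn /= map_mpolyX.
have Lminor i : L (\det (rowsub (dset_elt i) (shift_mx K m d))) = 0.
  have := congr1 (fun w : 'rV_(_) => (w 0 i)%:MP_[d]) vW0.
  rewrite !mxE mpolyC0 => <-.
  rewrite raddf_sum; apply: eq_bigr => u _ /=; rewrite !mxE mpolyCM mulrC.
  by rewrite minorK mcoeff_map_mpoly.
have Lprod : L (\prod_a zeta a) = 0.
  apply: (mulfI detV); rewrite mulr0 -LC mulrC -det_map_mx -det_tr.
  have -> : \prod_a zeta a = \det (diag_mx (\row_a zeta a)).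
    by rewrite det_diag; apply: eq_bigr => a _; rewrite mxE.
  rewrite -det_mulmx -factor Cauchy_Binet L_sum big1 // => i _.
  have -> : colsub (dset_elt i) (map_mx (@mpolyC m.+1 K) X) =
            map_mx (@mpolyC m.+1 K) (colsub (dset_elt i) X).
    by apply/matrixP=> a c; rewrite !mxE.
  by rewrite det_map_mx LC Lminor mulr0.
apply/rowP=> u0; rewrite mxE.
have [f def_f] := mnm_sum_onto (mdeg_monomial u0).
(* The exponents of X recover f, so only f contributes to this coefficient. *)
pose u1 : 'X_{1..d} := [multinom (f a : nat) | a < d].
have coef_prod u : ((\prod_a zeta a)@_(monomial u))@_u1 = (u0 == u)%:R.
  have -> : \prod_a zeta a = \sum_(h : {ffun 'I_d -> 'I_m.+1})
      ('X_[[multinom (h a : nat) | a < d]] : K)%:MP * 'X_[\sum_a U_(h a)].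
    rewrite bigA_distr_bigA; apply: eq_bigr => h _.
    rewrite big_split (big_morph _ (@mpolyXD _ _) (@mpolyX0 _ _)) -rmorph_prod.
    congr (_%:MP * _).
    by rewrite mpolyXE_id; apply: eq_bigr => a _; rewrite mnmE.
  rewrite !raddf_sum (bigD1 f) //= [X in _ + X]big1 ?addr0 => [|h hf].
    rewrite mcoeffCM mcoeffX def_f (inj_eq (@monomial_inj _ _)) mulr_natr.
    by rewrite mcoeffMn mcoeffX eqxx.
  rewrite mcoeffCM mcoeffX mulr_natr mcoeffMn mcoeffX.
  case: eqP => [/mnmP eq_hf|_].
    case/eqP: hf; apply/ffunP=> a; apply/val_inj.
    by have := eq_hf a; rewrite !mnmE.
  by rewrite mul0rn.
have := congr1 (mcoeff u1) Lprod; rewrite mcoeff0 => <-.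
rewrite /L raddf_sum (bigD1 u0) //= [X in _ + X]big1 ?addr0 => [|u uu0].
  by rewrite mulrC mcoeffCM coef_prod eqxx mulr1.
by rewrite mulrC mcoeffCM coef_prod eq_sym (negPf uu0) mulr0.
Qed.

(** Both sides are equal to the binomial coefficient of m + d over d; the other
    inequality follows from wronski_mx_free. *)
Lemma leq_card_dsets_monomials : (#|dsets (m + d) d| <= #|monomials m.+1 d|)%N.
Proof.
have -> : #|dsets (m + d) d| = 'C(m + d, m).
  by rewrite /dsets card_draws card_ord -[in RHS]bin_sub ?leq_addr // addKn.
rewrite -card_ord_partitions.
pose g (u : 'I_#|monomials m.+1 d|) : m.+1.-tuple 'I_d.+1 :=
  [tuple inord (monomial u l) | l < m.+1].
rewrite -[X in (_ <= X)%N]card_ord -cardsT.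
apply: leq_trans (leq_imset_card g _); apply/subset_leq_card/subsetP=> t.
rewrite inE => /eqP sum_t.
have [u def_u] : exists u : 'I_#|monomials m.+1 d|,
    monomial u = [multinom (tnth t l : nat) | l < m.+1].
  apply: monomial_onto; rewrite mdegE -[RHS]sum_t big_tuple.
  by apply: eq_bigr => l _; rewrite mnmE.
apply/imsetP; exists u => //; apply: eq_from_tnth => l.
by rewrite tnth_mktuple def_u mnmE inord_val.
Qed.

End Psi.

Lemma sym_translation_rsim (F : fieldType) (gT : finGroupType) (G : {group gT})
    (b : gT -> F) (bM : {in G &, {morph b : x y / (x * y)%g >-> x + y}}) m d :
  mx_rsim (sym_repr d (translation_repr bM m.+1))
          (ext_repr d (translation_repr bM (m + d))).
Proof.
apply: mx_rsim_sym; exists (wronski_mx F m d) => [||g Gg].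
- apply/eqP; rewrite eqn_leq leq_card_dsets_monomials /=.
  by rewrite -(eqP (wronski_mx_free F m d)) rank_leq_col.
- rewrite /row_free eqn_leq rank_leq_row /=.
  apply: leq_trans (leq_card_dsets_monomials m d) _.
  by have /eqP := wronski_mx_free F m d; rewrite mxrank_tr => ->.
- exact: wronski_mx_equivariant.
Qed.

End Wronskian.

(** * The regular summand of a translation module *)

Section RegularSummand.
Variables (F : fieldType) (gT : finGroupType) (G : {group gT}) (b : gT -> F).
Hypothesis bM : {in G &, {morph b : x y / (x * y)%g >-> x + y}}.
Hypothesis injb : {in G &, injective b}.

Definition eval_row n (a : F) : 'rV[F]_n := \row_k a ^+ k.

Lemma eval_row_translation n a c :
  eval_row n a *m translation_mx n c = eval_row n (a + c).
Proof.
apply/rowP=> k; rewrite !mxE.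
transitivity ((('X + c%:P) ^+ k).[a]); last by rewrite !hornerE.
rewrite (@horner_coef_wide _ n) ?size_XaddCn //.
by apply: eq_bigr => j _; rewrite !mxE mulrC.
Qed.

Lemma eval_row_poly n a (p : {poly F}) :
  (size p <= n)%N -> (eval_row n a *m \col_k p`_k) 0 0 = p.[a].
Proof.
move=> szp; rewrite (horner_coef_wide _ szp) mxE.
by apply: eq_bigr => k _; rewrite !mxE mulrC.
Qed.

(** The retraction onto the span of the evaluations is built from e, a
    polynomial vanishing at all the points b(x) except b(1) = 0: its translates,
    suitably scaled, form a basis dual to the evaluations, and they have degree
    less than n because n is at least the number of points. *)
Lemma translation_regular_split n : (#|G| <= n)%N ->
  exists K : representation F G, mx_rsim (translation_repr bM n)
    (dadd_grepr (Representation (regular_repr F G)) K).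
Proof.
move=> leGn; have b1 := morph_group1 bM.
pose e : {poly F} := \prod_(x in (G :\ 1)%g) ('X - (b x)%:P).
have sze : (size e <= n)%N.
  rewrite /e -big_enum size_prod_XsubC -cardE.
  by rewrite (cardsD1 1%g G) group1 in leGn.
have e0 : e.[0] != 0.
  rewrite horner_prod; apply/prodf_neq0 => x /setD1P[nx1 Gx].
  by rewrite hornerXsubC sub0r oppr_eq0 -b1 (inj_in_eq injb).
have eb x : x \in G -> e.[b x] / e.[0] = (x == 1%g)%:R.
  move=> Gx; have [->|nx1] := eqVneq; first by rewrite b1 divff.
  rewrite horner_prod (bigD1 x) ?inE ?nx1 //= hornerXsubC subrr.
  by rewrite mul0r mul0r.
pose E : 'cV[F]_n := \col_k (e.[0]^-1 *: e)`_k.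
have evE x : x \in G -> (eval_row n (b x) *m E) 0 0 = (x == 1%g)%:R.
  move=> Gx; rewrite eval_row_poly ?hornerZ ?(mulrC _ e.[_]) ?eb //.
  exact: leq_trans (size_scale_leq _ _) sze.
pose S : 'M[F]_(#|G|, n) := \matrix_i eval_row n (b (enum_val i)).
(* Translating by b(g^-1) for the column of g makes T equivariant. *)
pose T : 'M[F]_(n, #|G|) :=
  \matrix_(k, j) (translation_mx n (b (enum_val j)^-1%g) *m E) k 0.
have colT j : col j T = translation_mx n (b (enum_val j)^-1%g) *m E.
  by apply/colP=> k; rewrite !mxE.
apply: (@rsim_split _ _ _ _ _ _ _ S T) => [g Gg|g Gg|].
- apply/row_matrixP=> i; rewrite !row_mul !rowK -rowE rowK.
  have Ggi := enum_valP i.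
  by rewrite gring_indexK ?groupM // eval_row_translation bM.
- apply/matrixP=> k j; rewrite [RHS]mxE.
  have Gj := enum_valP j.
  have Gjg : (enum_val j * g^-1)%g \in G by rewrite groupM ?groupV.
  rewrite (bigD1 (gring_index G (enum_val j * g^-1)%g)) //= big1 => [|l lj].
    rewrite !mxE gring_indexK // mulgKV gring_valK !eqxx mulr1 addr0.
    transitivity ((translation_mx n (b g) *m col j T) k 0).
      by rewrite !mxE; apply: eq_bigr => l _; rewrite !mxE.
    rewrite colT mulmxA translation_mxD -bM ?groupV //.
    by rewrite invMg invgK !mxE.
  rewrite !mxE /= [_ == _](_ : _ = false) ?mulr0 //.
  apply: contraNF lj => /eqP ->; have Gl := enum_valP l.
  by rewrite gring_indexK ?groupM // mulgK gring_valK.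
- apply/matrixP=> i j; rewrite [RHS]mxE.
  have [Gi Gj] := (enum_valP i, enum_valP j).
  transitivity ((row i S *m col j T) 0 0).
    by rewrite !mxE; apply: eq_bigr => k _; rewrite !mxE.
  rewrite rowK colT mulmxA eval_row_translation -bM ?groupV //.
  rewrite evE ?groupM ?groupV //.
  by rewrite -eq_mulgV1 (inj_eq enum_val_inj).
Qed.

End RegularSummand.

(** * Exterior powers of a module with a regular summand *)

Section ExteriorRegular.
Variables (F : fieldType) (gT : finGroupType) (G : {group gT}).
Variables (K : representation F G) (d : nat).
Local Notation q := #|G|.
Local Notation k := (rdegree K).
Local Notation R := (dadd_grepr (Representation (regular_repr F G)) K).

(** Off the second block, g acts as a permutation of the basis. *)
Lemma regular_dadd_support g (u v : 'I_(q + k)) : R g u v != 0 ->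
  (exists2 l, u = lshift k l & v = lshift k (gring_index G (enum_val l * g)%g))
  \/ (exists u' v', u = rshift q u' /\ v = rshift q v').
Proof.
rewrite /=; case: (split_ordP u) => u' ->; case: (split_ordP v) => v' ->.
- rewrite block_mxEul !mxE /=.
  by have [->|_] := eqVneq v' _; [left; exists u' | rewrite eqxx].
- by rewrite block_mxEur mxE eqxx.
- by rewrite block_mxEdl mxE eqxx.
- by right; exists u', v'.
Qed.

(** The group elements whose basis vectors occur in the i-th wedge product. *)
Definition group_trace (i : 'I_#|dsets (q + k) d|) : {set gT} :=
  [set x in G | lshift k (gring_index G x) \in enum_val i].

(** A nonzero minor contains a nonzero transversal, which matches the basis
    vectors of the two wedge products through g. *)
Lemma group_trace_translate g (i j : 'I_#|dsets (q + k) d|) :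
  g \in G -> ext_mx d (R g) i j != 0 -> group_trace j = (group_trace i :* g)%g.
Proof.
move=> Gg; rewrite mxE => /det_neq0_transversal[s sP].
apply/setP=> y; rewrite mem_rcoset !inE groupMr ?groupV //.
case Gy: (y \in G) => //=; apply/idP/idP.
  rewrite -imset_dset_elt => /imsetP[c _ def_c].
  have := sP (s^-1%g c); rewrite mxE permKV -def_c.
  case/regular_dadd_support=> [[l def_u /lshift_inj yl]|[u' [v' [_ /eqP]]]];
    last by rewrite eq_lrshift.
  have Gl := enum_valP l.
  have -> : y = (enum_val l * g)%g.
    by rewrite -[y](@gring_indexK _ G y Gy) yl gring_indexK // groupM.
  by rewrite mulgK gring_valK -def_u enum_valP.
have Gyg : (y * g^-1)%g \in G by rewrite groupM ?groupV.
rewrite -{1}imset_dset_elt => /imsetP[a _ def_a].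
have := sP a; rewrite mxE -def_a.
case/regular_dadd_support=> [[l /lshift_inj <- def_v]|[u' [v' [/eqP]]]];
  last by rewrite eq_lrshift.
by rewrite gring_indexK // mulgKV in def_v; rewrite -def_v enum_valP.
Qed.

Definition trace_proj (B : {set gT}) : 'M[F]_#|dsets (q + k) d| :=
  diag_mx (\row_i (group_trace i == B)%:R).

Lemma trace_proj_perm g B : g \in G ->
  trace_proj B *m ext_repr d R g = ext_repr d R g *m trace_proj ('Rs%act B g).
Proof.
move=> Gg; apply/matrixP=> i j.
rewrite mul_diag_mx mul_mx_diag /= [LHS]mxE [RHS]mxE.
have [->|nz] := eqVneq (ext_mx d (R g) i j) 0; first by rewrite mulr0 mul0r.
rewrite mulrC !mxE (group_trace_translate Gg nz) rcosetE.
by rewrite (inj_eq (can_inj (rcosetK g))).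
Qed.

Lemma sum_trace_proj : \sum_B trace_proj B = 1%:M.
Proof.
apply/matrixP=> i j; rewrite summxE [RHS]mxE.
rewrite (bigD1 (group_trace i)) //= big1 ?addr0; first by rewrite !mxE eqxx.
by move=> B nB; rewrite !mxE eq_sym (negPf nB) mul0rn.
Qed.

(** At most rdegree K of the d factors of a wedge product come from K. *)
Lemma card_group_trace i : (d - k <= #|group_trace i| <= d)%N.
Proof.
pose f x := lshift k (gring_index G x).
have injf : {in group_trace i &, injective f}.
  move=> x y; rewrite !inE => /andP[Gx _] /andP[Gy _] /lshift_inj.
  by move/(congr1 enum_val); rewrite !gring_indexK.
rewrite -(card_in_imset injf) -{2}(card_dset i) leq_subLR; apply/andP; split.
  rewrite -{1}(card_dset i) -[X in (_ <= X + _)%N]card_ord -cardsT.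
  rewrite -(card_imset _ (@rshift_inj q k)).
  apply: leq_trans (leq_card_setU _ _); apply/subset_leq_card/subsetP=> u iu.
  rewrite inE; case: (split_ordP u) iu => u' -> iu; last by rewrite imset_f.
  apply/orP; right; apply/imsetP.
  exists (enum_val u'); last by rewrite /f gring_valK.
  by rewrite inE enum_valP gring_valK.
by apply/subset_leq_card/subsetP=> _ /imsetP[x + ->]; rewrite inE => /andP[].
Qed.

End ExteriorRegular.

(** The coset y H of the stabilizer H avoids B as soon as y does. *)
Lemma leq_card_translation_stab (gT : finGroupType) (G : {group gT})
    (B : {set gT}) :
  B \proper G -> (#|('C_G[B | 'Rs])%g| <= #|G| - #|B|)%N.
Proof.
case/properP=> sBG [y Gy nBy]; rewrite -cardsDS // -(card_lcoset _ y).
apply/subset_leq_card/subsetP=> _ /lcosetP[h /setIP[Gh /astab1P]] + ->.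
rewrite /= rcosetE => Bh; rewrite inE groupM // andbT.
by apply: contra nBy; rewrite -{1}Bh mem_rcoset mulgK.
Qed.

Theorem theorem1p5 (p : nat) (hp : prime p)
    (gT : finGroupType) (E : {group gT}) (hE : (p.-abelem E)%g)
    (q : nat) (hq : #|E| = q)
    (F : fieldType) (hF : p \in [pchar F]%R)
    (V : mx_representation F E 2) (faithV : mx_faithful V)
    (indV : mx_indecomposable V)
    (m d : nat) (hm : (m < q)%N) (hd : (d < q)%N) (hmd : (q <= m + d)%N) :
  relatively_projective
    [set H : subgroup_of E | (#|val H| <= m)%N]
    (sym_repr d (dual_repr (sym_repr m V))).
Proof.
have [V' simV shV] := shear_form V hF hE.
pose b g := V' g^-1%g 0 1.
have bM : {in E &, {morph b : x y / (x * y)%g >-> x + y}}.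
  move=> x y Ex Ey; rewrite /b invMg repr_mxM ?groupV // mxE.
  rewrite !big_ord_recl big_ord0.
  have [y00 _ _] := shV _ (groupVr Ey); have [_ _ x11] := shV _ (groupVr Ex).
  by rewrite lift0_ord2 y00 x11 mul1r mulr1 addr0.
have injb : {in E &, injective b}.
  move=> x y Ex Ey bxy; apply: invg_inj.
  have faithV' : mx_faithful V' by rewrite -(mx_rsim_faithful simV).
  apply: (mx_faithful_inj faithV'); rewrite ?groupV //.
  have [x00 x10 x11] := shV _ (groupVr Ex).
  have [y00 y10 y11] := shV _ (groupVr Ey).
  apply/matrixP=> i j; case: (ord_eq01 i) (ord_eq01 j) => -> [] ->;
    by rewrite ?x00 ?y00 ?x10 ?y10 ?x11 ?y11.
have le_q : (#|E| <= m + d)%N by rewrite hq.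
have [K simK] := translation_regular_split bM injb le_q.
have dimK : (m + d = q + rdegree K)%N by rewrite -hq; case: simK.
have sim : mx_rsim (sym_repr d (dual_repr (sym_repr m V)))
    (ext_repr d (dadd_grepr (Representation (regular_repr F E)) K)).
  apply: mx_rsim_trans (ext_repr_rsim d simK).
  apply: mx_rsim_trans (sym_translation_rsim bM m d).
  apply: sym_repr_rsim.
  apply: mx_rsim_trans (dual_sym_shear_rsim bM m shV _) => //.
  exact/dual_repr_rsim/sym_repr_rsim.
apply: (relatively_projective_rsim_family sim (@trace_proj_perm _ _ _ K d)
          (@sum_trace_proj _ _ _ K d)) => B nzPB.
have [i /eqP def_B] : exists i, @group_trace _ _ E K d i == B.
  apply/existsP; apply: contraNT nzPB; rewrite negb_exists => /forallP none.
  by apply/eqP/matrixP=> i j; rewrite !mxE (negPf (none i)) mul0rn.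
have := card_group_trace i; rewrite def_B => /andP[le_B ge_B].
have prB : B \proper E.
  rewrite properEcard hq (leq_ltn_trans ge_B hd) andbT -def_B.
  by apply/subsetP=> x; rewrite inE => /andP[].
exists (exist _ ('C_E[B | 'Rs])%G (subsetIl _ _)) => //.
rewrite inE /=; apply: leq_trans (leq_card_translation_stab prB) _.
rewrite hq leq_subLR; move: le_B; rewrite leq_subLR => le_B.
rewrite -(leq_add2r (rdegree K)) -dimK [(_ + m)%N]addnC -addnA leq_add2l.
by rewrite addnC.
Qed.
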